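(* As $x\to\infty$, $$\sum_{n\le x}A(n)=\frac{M}{2}x^2+O\left(x\log^3 x\right),$$ where $A(n)$ is the arithmetic mean of the exponents of the subgroups of $\mathbb{Z}_n\times\mathbb{Z}_n$ and $$M=\prod_p\left(1-\frac1{p}\right)\sum_{\nu=0}^{\infty}\frac{(p^{\nu+1}-1)^2}{p^{2\nu}\left(p^{\nu+2}+p^{\nu+1}-(2\nu+3)p+2\nu+1\right)},$$ the product being over all primes $p$.
   Context: $\mathbb{Z}_n$ denotes the cyclic group of order $n$. For a positive integer $n$, $A(n)$ is the sum of $\exp(H)$ over all subgroups $H$ of $\mathbb{Z}_n\times\mathbb{Z}_n$ divided by the total number of subgroups of $\mathbb{Z}_n\times\mathbb{Z}_n$. The sum $\sum_{n\le x}$ is over positive integers $n\le x$. *)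

(* Defs.v *)
From HB Require Import structures.
From mathcomp Require Import all_boot all_order all_algebra.
From mathcomp Require Import all_fingroup all_solvable.
From mathcomp Require Import all_classical all_reals all_analysis.

Set Implicit Arguments.
Unset Strict Implicit.
Unset Printing Implicit Defensive.

Import Order.TTheory GRing.Theory Num.Theory.
Import numFieldNormedType.Exports.

Local Open Scope classical_set_scope.
Local Open Scope ring_scope.

(* The Landau notations need the filter of neighbourhoods of +oo to be a
   canonical [filter_on]. *)
Canonical pinfty_nbhs_filter_on (R : numFieldType) : filter_on R :=
  FilterType (pinfty_nbhs R) _.

(* [Zp n] is the additive group Z/nZ for every n >= 1: all of ['Z_n] when
   n > 1, and the trivial subgroup of ['Z_1] (which is Z/2Z) when n = 1. *)
Definition Zsq (n : nat) : {group 'Z_n * 'Z_n} := setX_group (Zp_group n) (Zp_group n).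

Definition mean_exponent (R : realType) (n : nat) : R :=
  (\sum_(H in subgroups (Zsq n)) (exponent H)%:R) / #|subgroups (Zsq n)|%:R.

Definition M_term (R : realType) (p nu : nat) : R :=
  (p%:R ^+ nu.+1 - 1) ^+ 2
  / (p%:R ^+ (2 * nu)
     * (p%:R ^+ nu.+2 + p%:R ^+ nu.+1 - (2 * nu + 3)%:R * p%:R + (2 * nu + 1)%:R)).

Definition M_factor (R : realType) (p : nat) : R :=
  (1 - p%:R^-1) * limn (series (M_term R p)).

Definition M_partial (R : realType) (N : nat) : R :=
  \prod_(0 <= p < N | prime p) M_factor R p.

(* [limn] is total; the theorem also asserts that the limits it is applied to
   here and in [M_factor] exist. *)
Definition M_const (R : realType) : R := limn (M_partial R).

(* Main.v *)
Require Import Defs.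
From mathcomp Require Import all_boot all_order all_algebra.
From mathcomp Require Import all_fingroup all_solvable.
From mathcomp Require Import ring lra zify.

Set Implicit Arguments.
Unset Strict Implicit.
Unset Printing Implicit Defensive.

Import Order.TTheory GRing.Theory Num.Theory.

(** Write sigma(n) for the sum of the divisors of n and s(n) for the sum of
    gcd(a, b) over all pairs (a, b) of divisors of n.

    Counting the subgroups of a product of two cyclic groups by their first
    projection and their intersection with the second factor gives s(n) for
    Z_n x Z_n ([card_subgroups_setX_cyclic]).  The subgroups whose exponent
    divides k are exactly the subgroups of the k-torsion, again a product of two
    cyclic groups, so the same count determines how the exponents are
    distributed: they take each value as often as lcm(a, b) does when the pair
    (a, b) is given the weight gcd(a, b).  As gcd(a, b) lcm(a, b) = a b, the
    exponents sum to sigma(n)^2 ([sum_exponent_subgroups]), and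
    A(n) = sigma(n)^2 / s(n).

    Hence A(n) / n is multiplicative and equals the sum of G(d) over d | n for a
    multiplicative G ([mean_expand]), where G(p^k) is the difference of two
    consecutive values of A(p^k) / p^k.  The recursions
    sigma(p^(k+1)) = 1 + p sigma(p^k) and s(p^(k+1)) = 2k + 3 + p s(p^k) make
    the leading terms of that difference cancel, which leaves
    |G(n)| <= tau_3(n) / n, with tau_3 the number of factorizations in three
    factors ([mean_coef_bound]).

    Writing n = d e turns the sum of A(n) over n <= x into the sum of
    d G(d) (1 + ... + floor(x / d)), that is x^2 / 2 times the sum of G(d) / d
    over d <= x, up to x / 2 times the sum of |G(d)|.  With H(x) the harmonic
    sum, the sum of tau_3(d) / d over d <= x is at most H(x)^3
    ([sum_tau3_le]), and a dyadic decomposition deduces that the tail of the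
    series of tau_3(d) / d^2 is O(H(x)^3 / x) ([sum_tau3_tail]).  Both errors are
    therefore O(x log^3 x).  Finally the series of G(d) / d converges absolutely,
    so its sum is the limit of the Euler products ([cvg_M_partial]), whose factor
    at p is (1 - 1 / p) times the series of A(p^k) / p^(2k) by summation by parts
    ([sum_mean_diff_div]). *)

(** * Subgroups of a product of two cyclic groups *)

Lemma sum_divisors_div (F : nat -> nat) n : 0 < n ->
  \sum_(d <- divisors n) F (n %/ d) = \sum_(d <- divisors n) F d.
Proof.
move=> n_gt0; rewrite -(big_map (fun d => n %/ d) xpredT F).
have divK d : d \in divisors n -> n %/ (n %/ d) = d.
  by rewrite -dvdn_divisors // => d_dv; rewrite divnA // mulKn.
apply/perm_big/uniq_perm; rewrite ?divisors_uniq //.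
  rewrite map_inj_in_uniq ?divisors_uniq // => d e dn en eq_de.
  by rewrite -(divK d dn) eq_de divK.
move=> d; apply/mapP/idP => [[e]|dn].
  by rewrite -!dvdn_divisors // => e_dv ->; rewrite dvdn_div.
by exists (n %/ d); rewrite ?divK // -dvdn_divisors // dvdn_div // dvdn_divisors.
Qed.

Section SubgroupCount.
Local Open Scope group_scope.

(** A cyclic group has exactly one subgroup of each order dividing its own, and
    with g the gcd below this subgroup of order g consists of the solutions. *)
Lemma card_Ldiv_cyclic (gT : finGroupType) (B : {group gT}) (m : nat) :
  cyclic B -> #|'Ldiv_m(B)| = gcdn m #|B|.
Proof.
move=> cycB; case/cyclicP: (cycB) => x defB.
set g := gcdn m #|B|.
have g_dvd : g %| #[x] by rewrite orderE -defB dvdn_gcdr.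
have g_gt0 : 0 < g by rewrite (dvdn_gt0 _ g_dvd) ?order_gt0.
pose C := <[x ^+ (#[x] %/ g)]>%G.
have cardC : #|C| = g.
  by rewrite -orderE orderXdiv ?dvdn_div // divnA // mulKn ?order_gt0.
have sCB : C \subset B by rewrite defB cycleX.
suff -> : 'Ldiv_m(B) = C by [].
apply/setP=> y; apply/LdivP/idP => [[By ym1]|Cy].
  have sYB : <[y]> \subset B by rewrite cycle_subG.
  rewrite -cycle_subG -(cardSg_cyclic cycB sYB sCB) cardC dvdn_gcd.
  by rewrite -orderE order_dvdn ym1 eqxx order_dvdG.
split; first exact: (subsetP sCB).
by apply/eqP; rewrite -order_dvdn (dvdn_trans (order_dvdG Cy)) ?cardC ?dvdn_gcdl.
Qed.

(** The order is a bijection from the subgroups of a cyclic group to the divisors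
    of its order. *)
Lemma sum_subgroups_cyclic (gT : finGroupType) (A : {group gT}) (F : nat -> nat) :
  cyclic A -> \sum_(H in subgroups A) F #|H| = \sum_(d <- divisors #|A|) F d.
Proof.
move=> cycA; rewrite -big_enum -(big_map (fun H : {group gT} => #|H|) xpredT F).
apply/perm_big/uniq_perm; last 1 first.
- move=> d; rewrite -dvdn_divisors //; apply/mapP/idP => [[H]|].
    by rewrite mem_enum inE => sHA ->; apply: cardSg.
  case/cyclicP: (cycA) => x defA d_dv.
  have := cycle_sub_group (a := x) (m := d); rewrite orderE -defA => /(_ d_dv).
  move/setP/(_ <[x ^+ (#|A| %/ d)]>%G); rewrite !inE eqxx => /andP[sHA /eqP oH].
  by eexists; last exact: esym oH; rewrite mem_enum inE.
- rewrite map_inj_in_uniq ?enum_uniq // => H K; rewrite !mem_enum !inE.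
  move=> sHA sKA /eqP; rewrite -(eq_subG_cyclic cycA) // => /eqP eqHK.
  exact: val_inj.
- exact: divisors_uniq.
Qed.

Variables (aT bT : finGroupType) (A : {group aT}) (B : {group bT}).
Hypotheses (cycA : cyclic A) (cycB : cyclic B).
Implicit Types (H : {group aT * bT}).

Definition proj1_group H : {group aT} := (@fst_morphism aT bT @* H)%G.

(** The intersection of [H] with the second factor, seen inside that factor. *)
Definition fiber1_group H : {group bT} := (@pair1g_morphism aT bT @*^-1 H)%G.

Lemma mem_proj1 H x : reflect (exists y, (x, y) \in H) (x \in proj1_group H).
Proof.
apply: (iffP morphimP) => [[[x' y] _ Hxy /= ->]|[y Hxy]]; first by exists y.
by exists (x, y); rewrite ?inE.
Qed.

Lemma mem_fiber1 H y : (y \in fiber1_group H) = ((1, y) \in H).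
Proof. by rewrite !inE. Qed.

Lemma expg_pair (x : aT) (y : bT) i : (x, y) ^+ i = (x ^+ i, y ^+ i).
Proof. by elim: i => // i IHi; rewrite !expgS IHi. Qed.

(** Let [x] generate [A1]. A subgroup with projection [A1] and fiber [B1] is
    generated by [1 x B1] and one element [(x, y)]; the admissible [y] are those
    with [y ^+ #[x]] in [B1], i.e. the solutions of [y ^+ (#[x] * #|B1|) = 1], and
    two of them give the same subgroup exactly when they agree modulo [B1]. So the
    number of subgroups is the number of solutions divided by [#|B1|]. *)
Lemma card_subgroups_proj_fiber (A1 : {group aT}) (B1 : {group bT}) :
  A1 \subset A -> B1 \subset B ->
  #|[set H in subgroups (setX_group A B) |
       (proj1_group H == A1) && (fiber1_group H == B1)]|
  = gcdn #|A1| (#|B| %/ #|B1|).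
Proof.
move=> sA1A sB1B; case/cyclicP: (cyclicS sA1A cycA) => x defA1.
set S := [set H in _ | _].
have Ax : x \in A by rewrite -cycle_subG -defA1.
have abB := cyclic_abelian cycB.
have commB y z : y \in B -> z \in B -> y * z = z * y.
  by move=> By Bz; apply: (centsP abB).
have defB1 : B1 :=: 'Ldiv_#|B1|(B).
  apply/eqP; rewrite eqEcard card_Ldiv_cyclic // (gcdn_idPl (cardSg sB1B)) leqnn.
  rewrite andbT; apply/subsetP => z B1z; apply/LdivP.
  by rewrite (subsetP sB1B _ B1z) expg_cardG.
pose Y := [set y in B | y ^+ #[x] \in B1].
have cardY : #|Y| = gcdn (#[x] * #|B1|) #|B|.
  rewrite -card_Ldiv_cyclic //; apply: eq_card => y; rewrite !inE.
  by case By: (y \in B) => //=; rewrite {1}defB1 !inE groupX //= expgM.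
pose Phi y : {group aT * bT} := (<[(x, y)]> <*> setX 1 B1)%G.
have memPhi y : y \in B ->
    forall z, reflect (exists i w, w \in B1 /\ z = (x ^+ i, y ^+ i * w)) (z \in Phi y).
  move=> By z; have cPhi : setX_group 1 B1 \subset 'C(<[(x, y)]>).
    rewrite centsC cycle_subG; apply/centP => -[u w]; rewrite in_setX /=.
    case/andP=> /set1P-> B1w; congr (_, _); first by rewrite mulg1 mul1g.
    by apply: commB => //; apply: (subsetP sB1B).
  rewrite /= norm_joinEr ?cents_norm //.
  apply: (iffP mulsgP) => [[_ [u w] /cycleP[i ->]]|[i [w [B1w ->]]]].
    rewrite in_setX => /andP[/set1P-> B1w] ->; exists i, w; split=> //.
    by rewrite expg_pair; congr (_, _); rewrite mulg1.
  exists ((x, y) ^+ i) (1, w); rewrite ?mem_cycle //.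
    by rewrite in_setX /= set11.
  by rewrite expg_pair; congr (_, _); rewrite mulg1.
have PhiS y : y \in Y -> Phi y \in S.
  rewrite inE => /andP[By yxB1]; rewrite !inE; apply/and3P; split.
  - apply/subsetP=> _ /(memPhi y By)[i [w [B1w ->]]].
    by rewrite inE /= groupX // groupM ?groupX // (subsetP sB1B).
  - apply/eqP/val_inj/setP => u /=; rewrite defA1.
    apply/mem_proj1/cycleP => [[w /(memPhi y By)[i [w' [_ [-> _]]]]]|[i ->]].
      by exists i.
    by exists (y ^+ i); apply/(memPhi y By); exists i, 1; rewrite mulg1.
  apply/eqP/val_inj/setP => u /=; rewrite mem_fiber1.
  apply/(memPhi y By)/idP => [[i [w [B1w [xi ->]]]]|B1u]; last first.
    by exists 0, u; rewrite !expg0 mul1g.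
  rewrite groupM //; have /dvdnP[j ->] : #[x] %| i by rewrite order_dvdn xi.
  by rewrite mulnC expgM groupX.
(* H = Phi y is the same as (x, y) in H: this makes the fibers of Phi cosets. *)
have fiberPhi H : H \in S -> forall y, (y \in Y) && (Phi y == H) = ((x, y) \in H).
  rewrite !inE => /and3P[sHG /eqP projH /eqP fibH] y.
  apply/idP/idP => [/andP[/setIdP[By _] /eqP<-]|Hxy].
    by apply/(memPhi y By); exists 1%N, 1; rewrite !expg1 mulg1.
  have By : y \in B by have := subsetP sHG _ Hxy; rewrite inE => /andP[].
  rewrite inE By -fibH mem_fiber1 /=.
  have -> /= : (1, y ^+ #[x]) \in H.
    by have := groupX #[x] Hxy; rewrite expg_pair expg_order.
  apply/eqP/val_inj/setP => -[u v]; apply/(memPhi y By)/idP.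
    move=> [i [w [B1w ->]]]; have -> : (x ^+ i, y ^+ i * w) = (x, y) ^+ i * (1, w).
      by rewrite expg_pair; congr (_, _); rewrite mulg1.
    by rewrite groupM ?groupX // -mem_fiber1 fibH.
  move=> Huv; have /cycleP[i def_u] : u \in <[x]>.
    by rewrite -defA1 -projH; apply/mem_proj1; exists v.
  exists i, (y ^- i * v); rewrite mulKVg def_u; split=> //.
  rewrite -fibH mem_fiber1.
  have -> : (1, y ^- i * v) = ((x, y) ^+ i)^-1 * (u, v).
    by rewrite expg_pair; congr (_, _); rewrite def_u mulVg.
  by rewrite groupM ?groupV ?groupX.
have cardFib H : H \in S -> #|[set y in Y | Phi y == H]| = #|B1|.
  move=> SH; have /mem_proj1[y0 Hxy0] : x \in proj1_group H.
    by move: SH; rewrite !inE => /and3P[_ /eqP-> _]; rewrite /= defA1 cycle_id.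
  rewrite -(card_lcoset B1 y0); apply: eq_card => y; rewrite inE fiberPhi //.
  have /eqP <- : fiber1_group H == B1 by move: SH; rewrite !inE => /and3P[].
  rewrite mem_lcoset mem_fiber1 -(groupMl _ (groupVr Hxy0)).
  suff -> : (x, y0)^-1 * (x, y) = (1, y0^-1 * y) by [].
  by congr (_, _); rewrite mulVg.
have : #|Y| = (#|S| * #|B1|)%N.
  rewrite -sum1_card (partition_big Phi (mem S)) //=.
  rewrite -sum_nat_const; apply: eq_bigr => H SH.
  by rewrite -(cardFib H SH) -sum1_card; apply: eq_bigl => y; rewrite !inE.
rewrite cardY => /eqP; rewrite -{1}(divnK (cardSg sB1B)) -muln_gcdl.
by rewrite eqn_pmul2r ?cardG_gt0 // => /eqP <-; rewrite defA1.
Qed.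

(** Summing [card_subgroups_proj_fiber] over all [A1] and [B1]; replacing the
    order of [B1] by its index in [B] makes the count symmetric. *)
Lemma card_subgroups_setX_cyclic :
  #|subgroups (setX_group A B)|
  = \sum_(a <- divisors #|A|) \sum_(b <- divisors #|B|) gcdn a b.
Proof.
pose P H := (proj1_group H, fiber1_group H).
rewrite -sum1_card (partition_big P
  [pred p | (p.1 \in subgroups A) && (p.2 \in subgroups B)]) /=; last first.
  move=> H; rewrite !inE => /subsetP sHG; apply/andP; split; apply/subsetP => u.
    by case/mem_proj1 => v /sHG; rewrite inE => /andP[].
  by rewrite mem_fiber1 => /sHG; rewrite inE => /andP[].
rewrite -(pair_big (mem (subgroups A)) (mem (subgroups B)) (fun A1 B1 =>
   \sum_(H in subgroups (setX_group A B) | P H == (A1, B1)) 1%N)) /=.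
rewrite -(sum_subgroups_cyclic (fun a => \sum_(b <- divisors #|B|) gcdn a b) cycA).
apply: eq_bigr => A1; rewrite inE => sA1A.
rewrite -(sum_subgroups_cyclic (gcdn #|A1|) cycB).
transitivity (\sum_(B1 in subgroups B) gcdn #|A1| (#|B| %/ #|B1|)).
  apply: eq_bigr => B1; rewrite inE => sB1B.
  rewrite -card_subgroups_proj_fiber // -sum1_card.
  by apply: eq_bigl => H; rewrite !inE xpair_eqE.
rewrite (sum_subgroups_cyclic (fun b => gcdn #|A1| (#|B| %/ b)) cycB).
by rewrite (sum_divisors_div (gcdn #|A1|)) // (sum_subgroups_cyclic _ cycB).
Qed.
End SubgroupCount.

(** * The sum of the exponents *)

Section ExponentCount.
Local Open Scope group_scope.
Variables (aT bT : finGroupType) (A : {group aT}) (B : {group bT}).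
Hypotheses (cycA : cyclic A) (cycB : cyclic B).

Lemma dvdn_exponent_setX (H : {group aT * bT}) k : H \subset setX A B ->
  (exponent H %| k) = (H \subset setX 'Ldiv_k(A) 'Ldiv_k(B)).
Proof.
move=> /subsetP sHG; apply/exponentP/subsetP => [Hk [x y] Hxy|sHk [x y] Hxy].
  have /= := sHG _ Hxy; rewrite !in_setX /= => /andP[Ax By].
  have := Hk _ Hxy; rewrite expg_pair => -[xk yk].
  by rewrite !inE Ax By xk yk !eqxx.
have := sHk _ Hxy; rewrite in_setX /= => /andP[/LdivP[_ xk] /LdivP[_ yk]].
by rewrite expg_pair xk yk.
Qed.

(** These are the subgroups of the [k]-torsion, which is the product of the
    cyclic groups ['Ldiv_k(A)] and ['Ldiv_k(B)]. *)
Lemma card_subgroups_exponent_dvdn k :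
  #|[set H in subgroups (setX_group A B) | exponent H %| k]|
  = \sum_(a <- divisors (gcdn k #|A|)) \sum_(b <- divisors (gcdn k #|B|)) gcdn a b.
Proof.
pose Ak := Group (group_Ldiv k (cyclic_abelian cycA)).
pose Bk := Group (group_Ldiv k (cyclic_abelian cycB)).
have sAk : Ak \subset A by apply: subsetIl.
have sBk : Bk \subset B by apply: subsetIl.
rewrite -!card_Ldiv_cyclic // -(card_subgroups_setX_cyclic (A := Ak) (B := Bk));
  rewrite ?(cyclicS sAk) ?(cyclicS sBk) //.
apply: eq_card => H; rewrite !inE; apply/andP/idP => [[sHG]|sHk].
  by rewrite dvdn_exponent_setX.
have sHG : H \subset setX A B by apply: subset_trans sHk (setXS sAk sBk).
by rewrite dvdn_exponent_setX.
Qed.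
End ExponentCount.

Lemma partition_big_divisors (I : eqType) (r : seq I) (e w : I -> nat) k : 0 < k ->
  \sum_(i <- r | e i %| k) w i
  = \sum_(d <- divisors k) \sum_(i <- r | e i == d) w i.
Proof.
move=> k_gt0; rewrite big_mkcond (exchange_big_dep xpredT) //=; apply: eq_bigr => i _.
case: ifP => ek; last first.
  rewrite big_seq_cond big1 // => d /andP[]; rewrite -dvdn_divisors // => dk /eqP eid.
  by rewrite -eid ek in dk.
rewrite -big_filter (_ : filter _ _ = [:: e i]) ?big_seq1 //.
rewrite (eq_filter (a2 := pred1 (e i))) => [|d]; last by rewrite /= eq_sym.
by rewrite filter_pred1_uniq ?divisors_uniq // -dvdn_divisors.
Qed.

(** A finite weighted family of positive integers is determined by the weights of
    the members dividing [k], for all [k]: the weight of the value [k] itself is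
    recovered by induction over the divisors of [k], as in Moebius inversion. The
    values are indexed by the divisors of the common multiple [K]. *)
Lemma eq_sum_of_dvdn_counts (I J : eqType) (r : seq I) (s : seq J) (e w : I -> nat)
    (e' w' : J -> nat) K (F : nat -> nat) : 0 < K ->
  {in r, forall i, e i %| K} -> {in s, forall j, e' j %| K} ->
  (forall k, 0 < k -> \sum_(i <- r | e i %| k) w i = \sum_(j <- s | e' j %| k) w' j) ->
  \sum_(i <- r) w i * F (e i) = \sum_(j <- s) w' j * F (e' j).
Proof.
move=> K_gt0 eK e'K eq_cnt.
have eq_fiber k : 0 < k ->
    \sum_(i <- r | e i == k) w i = \sum_(j <- s | e' j == k) w' j.
  elim/ltn_ind: k => k IHk k_gt0; move: (eq_cnt k k_gt0).
  rewrite !partition_big_divisors // !(bigD1_seq k) ?divisors_uniq ?divisors_id //=.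
  suff -> : \sum_(d <- divisors k | d != k) \sum_(i <- r | e i == d) w i
      = \sum_(d <- divisors k | d != k) \sum_(j <- s | e' j == d) w' j.
    exact: addIn.
  rewrite big_seq_cond [RHS]big_seq_cond; apply: eq_bigr => d /andP[].
  rewrite -dvdn_divisors // => d_dv d_neq; apply: IHk.
    by rewrite ltn_neqAle d_neq dvdn_leq.
  exact: dvdn_gt0 d_dv.
have by_fiber (L : eqType) (t : seq L) (f v : L -> nat) : {in t, forall i, f i %| K} ->
    \sum_(i <- t) v i * F (f i)
    = \sum_(d <- divisors K) (\sum_(i <- t | f i == d) v i) * F d.
  move=> fK; transitivity (\sum_(i <- t | f i %| K) v i * F (f i)).
    rewrite big_seq [RHS]big_seq_cond; apply: eq_bigl => i.
    by case: (boolP (i \in t)) => //= /fK ->.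
  rewrite partition_big_divisors //; apply: eq_bigr => d _.
  by rewrite big_distrl; apply: eq_bigr => i /eqP ->.
rewrite (by_fiber I) // (by_fiber J) //; rewrite big_seq [RHS]big_seq; apply: eq_bigr => d.
by rewrite -dvdn_divisors // => d_dv; rewrite eq_fiber // (dvdn_gt0 K_gt0).
Qed.

Lemma sum_divisors_gcdn (F : nat -> nat) k n : 0 < k -> 0 < n ->
  \sum_(d <- divisors (gcdn k n)) F d = \sum_(d <- divisors n | d %| k) F d.
Proof.
move=> k_gt0 n_gt0; rewrite -[RHS]big_filter; apply/perm_big/uniq_perm.
- exact: divisors_uniq.
- by rewrite filter_uniq ?divisors_uniq.
by move=> d; rewrite mem_filter -!dvdn_divisors ?gcdn_gt0 ?k_gt0 // dvdn_gcd.
Qed.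

Definition sigma n := \sum_(d <- divisors n) d.
(** The number of subgroups of Z_n x Z_n. *)
Definition gcd_sum n := \sum_(a <- divisors n) \sum_(b <- divisors n) gcdn a b.

(** By [card_subgroups_exponent_dvdn] the exponents are distributed as
    [lcmn a b] with weight [gcdn a b], for [a] and [b] dividing the two orders,
    and [lcmn a b * gcdn a b = a * b]. *)
Lemma sum_exponent_subgroups (aT bT : finGroupType) (A : {group aT}) (B : {group bT}) :
    cyclic A -> cyclic B ->
  \sum_(H in subgroups (setX_group A B)) exponent H = sigma #|A| * sigma #|B|.
Proof.
move=> cycA cycB; pose K := lcmn #|A| #|B|.
have K_gt0 : 0 < K by rewrite lcmn_gt0 !cardG_gt0.
set S := subgroups _.
transitivity (\sum_(H <- enum S) 1 * exponent H).
  by rewrite big_enum; apply: eq_bigr => H _; rewrite mul1n.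
pose s := [seq (a, b) | a <- divisors #|A|, b <- divisors #|B|].
rewrite (eq_sum_of_dvdn_counts (s := s) (e := fun H : {group aT * bT} => exponent H)
  (w' := fun p => gcdn p.1 p.2) (e' := fun p => lcmn p.1 p.2) (fun d => d) K_gt0).
- rewrite big_allpairs /= /sigma big_distrlr /=.
  by do 2![apply: eq_bigr => ? _]; rewrite mulnC muln_lcm_gcd.
- move=> H; rewrite mem_enum inE => sHG; apply/exponentP => -[x y] /(subsetP sHG).
  rewrite in_setX => /andP[Ax By]; rewrite expg_pair; apply/eqP.
  rewrite xpair_eqE -!order_dvdn (dvdn_trans (order_dvdG Ax)) ?dvdn_lcml //.
  by rewrite (dvdn_trans (order_dvdG By)) ?dvdn_lcmr.
- move=> _ /allpairsP[[a b] [/= aA bB ->]] /=; rewrite -!dvdn_divisors // in aA bB.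
  by rewrite dvdn_lcm (dvdn_trans aA) ?dvdn_lcml ?(dvdn_trans bB) ?dvdn_lcmr.
move=> k k_gt0; rewrite big_enum_cond /=.
transitivity #|[set H in S | exponent H %| k]|.
  by rewrite -sum1_card; apply: eq_bigl => H; rewrite !inE.
rewrite card_subgroups_exponent_dvdn // sum_divisors_gcdn //.
rewrite [RHS]big_mkcond /s big_allpairs /= [LHS]big_mkcond /=; apply: eq_bigr => a _.
under [RHS]eq_bigr => b _ do rewrite dvdn_lcm.
case: ifP => /= ak; last by rewrite big1.
by rewrite sum_divisors_gcdn // big_mkcond.
Qed.

Lemma cyclic_Zp n : cyclic (Zp_group n).
Proof. by rewrite /= /Zp; case: ifP => _; rewrite ?cyclic1 // Zp_cycle cycle_cyclic. Qed.

(** * Divisor sums and multiplicative functions *)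

Lemma prime_power_ind (P : nat -> Prop) : P 1 ->
  (forall p k m, prime p -> 0 < m -> ~~ (p %| m) -> P m -> P (p ^ k * m)) ->
  forall n, 0 < n -> P n.
Proof.
move=> P1 PM; elim/ltn_ind => n IHn n_gt0.
have [->//|n_gt1] := eqVneq n 1.
have p_pr : prime (pdiv n) by rewrite pdiv_prime // ltn_neqAle eq_sym n_gt1.
have [m co_pm def_n] := pfactor_coprime p_pr n_gt0.
have m_gt0 : 0 < m by move: n_gt0; rewrite {1}def_n muln_gt0 => /andP[].
have logn_gt0 : 0 < logn (pdiv n) n by rewrite logn_gt0 mem_primes p_pr n_gt0 pdiv_dvd.
rewrite def_n mulnC; apply: PM => //; first by rewrite -prime_coprime.
apply: IHn => //; rewrite [ltnRHS]def_n ltn_Pmulr // -(exp1n (logn (pdiv n) n)).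
by rewrite ltn_exp2r ?prime_gt1.
Qed.

Lemma mem_divisors_gt0 n d : d \in divisors n -> 0 < d.
Proof.
case: n => [|n]; first by rewrite inE => /eqP ->.
by rewrite -dvdn_divisors // => /dvdn_gt0 ->.
Qed.

Local Open Scope ring_scope.

Lemma sum_divisors_pM (V : nmodType) (F : nat -> V) p k m :
  prime p -> (0 < m)%N -> ~~ (p %| m)%N ->
  \sum_(d <- divisors (p ^ k * m)) F d
  = \sum_(i < k.+1) \sum_(d <- divisors m) F (p ^ i * d)%N.
Proof.
move=> p_pr m_gt0 pNm; have p_gt0 := prime_gt0 p_pr.
have co_pm i : coprime (p ^ i) m by rewrite coprimeXl // prime_coprime.
rewrite -(big_mkord xpredT (fun i => \sum_(d <- divisors m) F (p ^ i * d)%N)).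
rewrite -(big_allpairs (F := fun z => F (p ^ z.1 * z.2)%N)).
rewrite -(big_map (fun z => p ^ z.1 * z.2)%N xpredT F).
apply/perm_big/uniq_perm; first exact: divisors_uniq.
  rewrite map_inj_in_uniq => [|z z'].
    by rewrite allpairs_uniq ?iota_uniq ?divisors_uniq //; case=> ? ? [].
  case/allpairsP=> -[i d] [_ dm ->] /allpairsP[[j e] [_ em ->]] /= eqz.
  rewrite /= -!dvdn_divisors // in dm em.
  have lognE l c : (c %| m)%N -> logn p (p ^ l * c) = l.
    move=> cm; have c_gt0 := dvdn_gt0 m_gt0 cm.
    rewrite lognM ?expn_gt0 ?p_gt0 // pfactorK // lognE p_pr c_gt0 /=.
    by rewrite ifN ?addn0 //; apply: contra pNm => /dvdn_trans; apply.
  have eq_ij : i = j by rewrite -(lognE i d dm) eqz lognE.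
  move/eqP: eqz; rewrite eq_ij eqn_pmul2l ?expn_gt0 ?p_gt0 // => /eqP ->.
  by [].
move=> d; rewrite -dvdn_divisors ?muln_gt0 ?expn_gt0 ?p_gt0 //.
apply/idP/mapP => [d_dv|[_ /allpairsP[[i e] [/= i_lt em ->]] ->] /=].
  have d_gt0 : (0 < d)%N by rewrite (dvdn_gt0 _ d_dv) ?muln_gt0 ?expn_gt0 ?p_gt0.
  have [e co_pe def_d] := pfactor_coprime p_pr d_gt0.
  exists (logn p d, e); last by rewrite mulnC.
  apply/allpairsP; exists (logn p d, e); split=> //=.
    rewrite mem_index_iota ltnS leq0n -(dvdn_Pexp2l _ _ (prime_gt1 p_pr)).
    rewrite -(Gauss_dvdl _ (co_pm _)) (dvdn_trans _ d_dv) //.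
    by rewrite [X in (_ %| X)%N]def_d dvdn_mull.
  rewrite -dvdn_divisors // -(@Gauss_dvdr _ (p ^ k)); last first.
    by rewrite coprime_sym coprimeXl.
  by rewrite (dvdn_trans _ d_dv) // def_d dvdn_mulr.
move: i_lt em; rewrite mem_index_iota ltnS -dvdn_divisors // => i_lt em.
by rewrite dvdn_mul // dvdn_exp2l.
Qed.

(** Dirichlet's rearrangement, along [n = d * e]. *)
Lemma sum_divisors_swap (V : nmodType) (F : nat -> nat -> V) X :
  \sum_(1 <= n < X.+1) \sum_(d <- divisors n) F d (n %/ d)%N
  = \sum_(1 <= d < X.+1) \sum_(1 <= e < (X %/ d).+1) F d e.
Proof.
transitivity (\sum_(1 <= n < X.+1) \sum_(1 <= d < X.+1 | (d %| n)%N) F d (n %/ d)%N).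
  rewrite big_seq [RHS]big_seq; apply: eq_bigr => n.
  rewrite mem_index_iota ltnS => /andP[n_gt0 nX].
  rewrite -[RHS]big_filter; apply/perm_big/uniq_perm.
  - exact: divisors_uniq.
  - by rewrite filter_uniq ?iota_uniq.
  move=> d; rewrite mem_filter mem_index_iota ltnS -dvdn_divisors //.
  case: (boolP (d %| n)%N) => //= d_dv.
  by rewrite (dvdn_gt0 n_gt0 d_dv) (leq_trans (dvdn_leq n_gt0 d_dv)).
rewrite (exchange_big_dep xpredT) //= big_seq [RHS]big_seq; apply: eq_bigr => d.
rewrite mem_index_iota ltnS => /andP[d_gt0 dX].
rewrite -big_filter (@perm_big _ _ _ _ _ [seq (d * e)%N | e <- index_iota 1 (X %/ d).+1]).
  by rewrite big_map; apply: eq_bigr => e _; rewrite mulKn.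
apply: uniq_perm.
- by rewrite filter_uniq ?iota_uniq.
- rewrite map_inj_uniq ?iota_uniq // => e f /eqP.
  by rewrite eqn_pmul2l // => /eqP.
move=> n; rewrite mem_filter mem_index_iota ltnS.
apply/andP/mapP => [[/dvdnP[e ->] /andP[n_gt0 nX]]|[e]].
  exists e; last by rewrite mulnC.
  by rewrite mem_index_iota ltnS leq_divRL // nX andbT; case: e n_gt0 {nX}.
rewrite mem_index_iota ltnS leq_divRL // mulnC => /andP[e_gt0 eX] ->.
by rewrite dvdn_mulr // eX muln_gt0 d_gt0 e_gt0.
Qed.

Section Multiplicative.
Variable R : comPzRingType.
Implicit Types (F : nat -> nat -> R).

(** The multiplicative function with value [F p k] at [p ^ k]. With the
    convention [F p 0 = 1], primes not dividing [n] may be included in the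
    product without changing it. *)
Definition multf F n := \prod_(p <- primes n) F p (logn p n).

Definition partial_sums F p k := \sum_(i < k.+1) F p i.

Lemma multf1 F : multf F 1 = 1.
Proof. by rewrite /multf big_nil. Qed.

Lemma multf_pM F p k m : (forall q, F q 0%N = 1) ->
  prime p -> (0 < m)%N -> ~~ (p %| m)%N ->
  multf F (p ^ k * m) = F p k * multf F m.
Proof.
move=> F0 p_pr m_gt0 pNm; have p_gt0 := prime_gt0 p_pr.
case: k => [|k]; first by rewrite expn0 mul1n F0 mul1r.
have pNpr : p \notin primes m by rewrite mem_primes p_pr m_gt0.
have perm_pr : perm_eq (primes (p ^ k.+1 * m)) (p :: primes m).
  apply: uniq_perm; rewrite /= ?primes_uniq ?pNpr // => q.
  by rewrite primesM ?expn_gt0 ?p_gt0 // primesX // primes_prime // !inE.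
have lognp : logn p m = 0%N by apply/eqP; rewrite -leqn0 leqNgt logn_gt0.
rewrite /multf (perm_big _ perm_pr) big_cons lognM ?expn_gt0 ?p_gt0 // pfactorK //.
rewrite lognp addn0; congr (_ * _).
rewrite big_seq [RHS]big_seq; apply: eq_bigr => q qm.
have q_pr : prime q by move: qm; rewrite mem_primes => /andP[].
rewrite lognM ?expn_gt0 ?p_gt0 // lognX logn_prime // eq_sym.
by case: eqP qm pNpr => [->|_ _ _]; [move=> -> | rewrite muln0].
Qed.

Lemma partial_sums0 F p : partial_sums F p 0 = F p 0%N.
Proof. by rewrite /partial_sums big_ord1. Qed.

(** The factorization of a divisor sum into its local factors; with [n] a power of
    a primorial it is also the finite form of the Euler product. *)
Lemma sum_divisors_multf F n : (forall q, F q 0%N = 1) -> (0 < n)%N ->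
  \sum_(d <- divisors n) multf F d = multf (partial_sums F) n.
Proof.
move=> F0; have S0 q : partial_sums F q 0 = 1 by rewrite partial_sums0.
elim/prime_power_ind => [|p k m p_pr m_gt0 pNm IHm].
  by rewrite (_ : divisors 1 = [:: 1%N]) // big_seq1 !multf1.
rewrite sum_divisors_pM // multf_pM // -IHm /partial_sums big_distrl /=.
apply: eq_bigr => i _; rewrite big_distrr big_seq [RHS]big_seq; apply: eq_bigr => d.
rewrite -dvdn_divisors // => dm; rewrite multf_pM //; first exact: dvdn_gt0 dm.
by apply: contra pNm => /dvdn_trans; apply.
Qed.

Lemma multfM F F' n : multf F n * multf F' n = multf (fun p k => F p k * F' p k) n.
Proof. by rewrite /multf big_split. Qed.

Lemma multf_natr n : (0 < n)%N -> multf (fun p k => p%:R ^+ k) n = n%:R.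
Proof.
elim/prime_power_ind => [|p k m p_pr m_gt0 pNm IHm]; first exact: multf1.
by rewrite multf_pM // IHm natrM natrX.
Qed.

Lemma multf1r n : multf (fun _ _ => 1) n = 1.
Proof. by rewrite /multf big1. Qed.
End Multiplicative.

(** * The local factors *)

Section LocalFactors.
Variable R : realFieldType.
Implicit Types (x : R) (k : nat).

(** For [x] a prime these are sigma(x^k) and s(x^k). *)
Definition sigma_loc x k : R := \sum_(i < k.+1) x ^+ i.
Definition gcd_loc x k : R := \sum_(i < k.+1) \sum_(j < k.+1) x ^+ minn i j.

Lemma sigma_loc0 x : sigma_loc x 0 = 1.
Proof. by rewrite /sigma_loc big_ord1 expr0. Qed.

Lemma gcd_loc0 x : gcd_loc x 0 = 1.
Proof. by rewrite /gcd_loc !big_ord1 expr0. Qed.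

Lemma sigma_locS x k : sigma_loc x k.+1 = 1 + x * sigma_loc x k.
Proof.
rewrite /sigma_loc big_ord_recl expr0 big_distrr; congr (_ + _).
by apply: eq_bigr => i _; rewrite exprS.
Qed.

(** The [2 * k + 3] pairs with [i = 0] or [j = 0] contribute 1 each, and the
    others are shifts of the pairs for [k]. *)
Lemma gcd_locS x k : gcd_loc x k.+1 = (2 * k + 3)%:R + x * gcd_loc x k.
Proof.
rewrite /gcd_loc big_ord_recl /=.
under eq_bigr => j _ do rewrite min0n expr0.
rewrite sumr_const card_ord.
under [X in _ + X]eq_bigr => i _.
  rewrite big_ord_recl /= minn0 expr0.
  under eq_bigr => j _ do rewrite minnSS exprS.
  rewrite -big_distrr /=.
  over.
rewrite big_split /= sumr_const card_ord -big_distrr /= addrA; congr (_ + _).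
by rewrite -natrD; congr _%:R; lia.
Qed.

Lemma sigma_loc_ge1 x k : 0 <= x -> 1 <= sigma_loc x k.
Proof.
move=> x_ge0; elim: k => [|k IHk]; first by rewrite sigma_loc0.
by rewrite sigma_locS lerDl mulr_ge0 // (le_trans ler01).
Qed.

Lemma le_sigma_gcd_loc x k : 0 <= x -> sigma_loc x k <= gcd_loc x k.
Proof.
move=> x_ge0; elim: k => [|k IHk]; first by rewrite sigma_loc0 gcd_loc0.
by rewrite sigma_locS gcd_locS lerD ?ler_wpM2l // ler1n addnS.
Qed.

Lemma gcd_loc_gt0 x k : 0 <= x -> 0 < gcd_loc x k.
Proof.
move=> x_ge0; rewrite (lt_le_trans ltr01) //.
exact: le_trans (sigma_loc_ge1 k x_ge0) (le_sigma_gcd_loc k x_ge0).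
Qed.

Lemma sigma_loc_closed x k : (x - 1) * sigma_loc x k = x ^+ k.+1 - 1.
Proof. by rewrite subrX1. Qed.

Lemma gcd_loc_closed x k :
  (x - 1) ^+ 2 * gcd_loc x k
  = x ^+ k.+2 + x ^+ k.+1 - (2 * k + 3)%:R * x + (2 * k + 1)%:R.
Proof.
elim: k => [|k IHk]; first by rewrite gcd_loc0 !exprS; ring.
rewrite gcd_locS mulrDr mulrCA IHk !exprS; ring.
Qed.

Lemma sigma_loc_le x k : 2 <= x -> sigma_loc x k <= 2 * x ^+ k.
Proof.
move=> x_ge2; suff : sigma_loc x k <= 2 * x ^+ k - 1 by lra.
elim: k => [|k IHk]; first by rewrite sigma_loc0 expr0; lra.
rewrite sigma_locS exprS; nra.
Qed.

(** The value A(x^k) / x^k for [x] a prime. *)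
Definition mean_loc x k : R := sigma_loc x k ^+ 2 / (x ^+ k * gcd_loc x k).

(** The Moebius transform of [mean_loc]: the value G(x^k) for [x] a prime. *)
Definition mean_diff x k : R :=
  if k is k'.+1 then mean_loc x k - mean_loc x k' else 1.

Lemma mean_loc0 x : mean_loc x 0 = 1.
Proof. by rewrite /mean_loc sigma_loc0 gcd_loc0 expr0 expr1n mulr1 divr1. Qed.

Lemma sum_mean_diff x k : \sum_(i < k.+1) mean_diff x i = mean_loc x k.
Proof.
elim: k => [|k IHk]; first by rewrite big_ord1 mean_loc0.
by rewrite big_ord_recr /= IHk addrC subrK.
Qed.

(** Over the common denominator, the recursions turn both terms of the difference
    into expressions containing [x ^+ 2 * sigma_loc x k ^+ 2 * gcd_loc x k]; what
    remains after cancelling it is of lower order. *)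
Lemma mean_diffS x k : 0 < x ->
  mean_diff x k.+1 * x ^+ k.+1 =
  (1 + 2 * x * sigma_loc x k) / gcd_loc x k.+1
  - (2 * k + 3)%:R * x * sigma_loc x k ^+ 2 / (gcd_loc x k.+1 * gcd_loc x k).
Proof.
move=> x_gt0; have x_ge0 := ltW x_gt0.
have s_neq0 := lt0r_neq0 (gcd_loc_gt0 k x_ge0).
have := lt0r_neq0 (gcd_loc_gt0 k.+1 x_ge0).
have xk_neq0 : x ^+ k != 0 by rewrite expf_neq0 ?lt0r_neq0.
rewrite /mean_diff /mean_loc gcd_locS sigma_locS (exprS x) => s'_neq0.
move: s'_neq0; move: (_%:R) => c s'_neq0.
by field; rewrite s_neq0 s'_neq0 xk_neq0 lt0r_neq0.
Qed.

(** The value of tau_3 at a [k]-th power of a prime, i.e. (k + 1)(k + 2) / 2. *)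
Definition tau3_loc k : R := \sum_(i < k.+1) \sum_(j < i.+1) 1.

Lemma tau3_loc_ge k : (2 * k + 3)%:R <= tau3_loc k.+1.
Proof.
have E j : tau3_loc j.+1 = tau3_loc j + j.+2%:R.
  by rewrite /tau3_loc big_ord_recr /= sumr_const card_ord.
elim: k => [|k IHk].
  by rewrite E /tau3_loc !big_ord1 -[1 + _](natrD _ 1).
rewrite E (_ : (2 * k.+1 + 3)%:R = (2 * k + 3)%:R + 2%:R); last first.
  by rewrite -natrD; congr _%:R; lia.
by rewrite lerD // ler_nat.
Qed.

(** In [mean_diffS] the first term lies in [[0, 2]] and the second one in
    [[0, 2 * k + 3]], since [sigma_loc x k <= gcd_loc x k] and
    [x * gcd_loc x k <= gcd_loc x k.+1]; and [2 * k + 3] is at most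
    [tau3_loc k.+1]. *)
Lemma mean_diff_bound x k : 1 <= x -> `|mean_diff x k| <= tau3_loc k / x ^+ k.
Proof.
move=> x_ge1; have x_gt0 : 0 < x by apply: lt_le_trans x_ge1.
have x_ge0 := ltW x_gt0; rewrite ler_pdivlMr ?exprn_gt0 //.
rewrite -{1}(ger0_norm (exprn_ge0 k x_ge0)) -normrM.
case: k => [|k]; first by rewrite /tau3_loc !big_ord1 expr0 mulr1 normr1.
apply: le_trans (tau3_loc_ge k); rewrite mean_diffS //.
have sig_ge1 := sigma_loc_ge1 k x_ge0; have le_sg := le_sigma_gcd_loc k x_ge0.
have g_gt0 := gcd_loc_gt0 k x_ge0; have g'_gt0 := gcd_loc_gt0 k.+1 x_ge0.
have g'E := gcd_locS x k; move: g'_gt0 g'E sig_ge1 le_sg g_gt0.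
set s := sigma_loc x k; set g := gcd_loc x k; set g' := gcd_loc x k.+1.
move=> g'_gt0 g'E s_ge1 le_sg g_gt0.
have c_ge3 : 3 <= (2 * k + 3)%:R :> R by rewrite ler_nat leq_addl.
move: c_ge3 g'E; set c := (2 * k + 3)%:R => c_ge3 g'E.
have u_ge0 : 0 <= (1 + 2 * x * s) / g' by rewrite divr_ge0 ?(ltW g'_gt0) //; nra.
have u_le2 : (1 + 2 * x * s) / g' <= 2 by rewrite ler_pdivrMr // g'E; nra.
have v_ge0 : 0 <= c * x * s ^+ 2 / (g' * g).
  by rewrite divr_ge0 ?mulr_ge0 ?exprn_ge0 //; lra.
have v_lec : c * x * s ^+ 2 / (g' * g) <= c.
  have xs2 : x * s ^+ 2 <= g' * g.
    have s2 : s ^+ 2 <= g * g by rewrite expr2 ler_pM //; lra.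
    have : x * s ^+ 2 <= x * (g * g) by rewrite ler_wpM2l.
    by rewrite g'E; nra.
  by rewrite ler_pdivrMr ?mulr_gt0 // -mulrA ler_wpM2l //; lra.
rewrite ler_norml; apply/andP; split; lra.
Qed.

End LocalFactors.

(** * The mean exponent as a divisor sum *)

Section GlobalMean.
Variable R : realFieldType.
Implicit Types n : nat.

(** The function G with A(n) / n equal to the sum of G(d) over d | n. *)
Definition mean_coef n : R := multf (fun p k => mean_diff p%:R k) n.

Definition tau3 n : nat := \sum_(d <- divisors n) \sum_(e <- divisors d) 1.

Lemma natr_sigma n : (0 < n)%N ->
  (sigma n)%:R = multf (fun p k => sigma_loc (p%:R : R) k) n.
Proof.
move=> n_gt0; rewrite /sigma natr_sum -(sum_divisors_multf (F := fun p k => p%:R ^+ k)) //.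
rewrite big_seq [RHS]big_seq; apply: eq_bigr => d /mem_divisors_gt0 d_gt0.
by rewrite multf_natr.
Qed.

(** Divisors of [p ^ k * m] are products [p ^ i * a] with [a %| m], and the gcd of
    two such products splits accordingly. *)
Lemma natr_gcd_sum n : (0 < n)%N ->
  (gcd_sum n)%:R = multf (fun p k => gcd_loc (p%:R : R) k) n.
Proof.
elim/prime_power_ind => [|p k m p_pr m_gt0 pNm IHm].
  by rewrite multf1 /gcd_sum (_ : divisors 1 = [:: 1%N]) // !big_seq1.
rewrite multf_pM // => [|q]; last exact: gcd_loc0.
have gcdE i j a b : (a %| m)%N -> (b %| m)%N ->
    gcdn (p ^ i * a) (p ^ j * b) = (p ^ minn i j * gcdn a b)%N.
  move=> am bm.
  have co l c : (c %| m)%N -> coprime (p ^ l) c.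
    by move=> cm; rewrite coprimeXl // (coprime_dvdr cm) // prime_coprime.
  wlog le_ij : i j a b am bm / (i <= j)%N.
    move=> IH; have [le_ij|/ltnW le_ji] := leqP i j; first by rewrite IH ?(minn_idPl le_ij).
    by rewrite [LHS]gcdnC (IH j i b a) // (minn_idPl le_ji) [gcdn b a]gcdnC.
  rewrite (minn_idPl le_ij) -(subnK le_ij) addnC expnD -mulnA -muln_gcdr.
  by rewrite Gauss_gcdr // coprime_sym co.
have castE l : (gcd_sum l)%:R
    = \sum_(a <- divisors l) \sum_(b <- divisors l) (gcdn a b)%:R :> R.
  by rewrite natr_sum; apply: eq_bigr => a _; rewrite natr_sum.
rewrite -IHm !castE sum_divisors_pM // /gcd_loc big_distrl /=.
apply: eq_bigr => i _; under [LHS]eq_bigr => a _ do rewrite sum_divisors_pM //.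
rewrite exchange_big big_distrl /=; apply: eq_bigr => j _.
rewrite big_distrr big_seq [RHS]big_seq; apply: eq_bigr => a.
rewrite -dvdn_divisors // => am; rewrite big_distrr big_seq [RHS]big_seq.
apply: eq_bigr => b; rewrite -dvdn_divisors // => bm.
by rewrite gcdE // natrM natrX.
Qed.

Lemma mean_expand n : (0 < n)%N ->
  (sigma n)%:R ^+ 2 / (gcd_sum n)%:R = n%:R * \sum_(d <- divisors n) mean_coef d.
Proof.
move=> n_gt0; rewrite sum_divisors_multf // -[in RHS](multf_natr R n_gt0) multfM.
rewrite natr_sigma // natr_gcd_sum // expr2 multfM.
rewrite /multf -prodf_div big_seq [RHS]big_seq; apply: eq_bigr => p.
rewrite mem_primes => /andP[p_pr _]; set k := logn p n.
rewrite /partial_sums sum_mean_diff /mean_loc [RHS]mulrCA [in RHS]invfM.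
by rewrite mulVKf ?expr2 // expf_neq0 // pnatr_eq0 -lt0n prime_gt0.
Qed.

Lemma natr_tau3 n : (0 < n)%N -> (tau3 n)%:R = multf (fun=> tau3_loc R) n.
Proof.
move=> n_gt0; rewrite /tau3 natr_sum.
rewrite -(sum_divisors_multf (F := fun=> fun k => \sum_(j < k.+1) 1)) //; last first.
  by move=> _; rewrite big_ord1.
rewrite big_seq [RHS]big_seq; apply: eq_bigr => d /mem_divisors_gt0 d_gt0.
rewrite -(sum_divisors_multf (F := fun=> fun=> 1)) // natr_sum.
by apply: eq_bigr => e _; rewrite multf1r.
Qed.

Lemma mean_coef_bound n : (0 < n)%N -> `|mean_coef n| <= (tau3 n)%:R / n%:R.
Proof.
move=> n_gt0; rewrite natr_tau3 // -[in leRHS](multf_natr R n_gt0).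
rewrite /multf -prodf_div normr_prod big_seq [leRHS]big_seq.
apply: ler_prod => p; rewrite mem_primes => /andP[p_pr _].
by rewrite normr_ge0 mean_diff_bound // ler1n prime_gt0.
Qed.

Definition harmonic_sum X : R := \sum_(1 <= n < X.+1) n%:R^-1.

(** [tau3] is the Dirichlet cube of the constant 1, and each convolution
    multiplies the sum by at most a harmonic sum. *)
Lemma sum_tau3_le X :
  \sum_(1 <= n < X.+1) (tau3 n)%:R / n%:R <= harmonic_sum X ^+ 3.
Proof.
have inv_ge0 n : 0 <= n%:R^-1 :> R by rewrite invr_ge0.
have dirichlet (u : nat -> R) : (forall n, 0 <= u n) ->
    \sum_(1 <= n < X.+1) \sum_(d <- divisors n) u d * (n %/ d)%:R^-1
    <= (\sum_(1 <= n < X.+1) u n) * harmonic_sum X.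
  move=> u_ge0; rewrite (sum_divisors_swap (fun d e => u d * e%:R^-1)) big_distrl.
  apply: ler_sum => d _; rewrite /= -big_distrr ler_wpM2l //.
  rewrite /harmonic_sum [leRHS](@big_cat_nat _ _ _ (X %/ d).+1) //=; last first.
    by rewrite ltnS leq_div.
  by rewrite lerDl sumr_ge0.
have divE n d : d \in divisors n -> (n%:R^-1 : R) = d%:R^-1 * (n %/ d)%:R^-1.
  case: n => [|n]; first by rewrite inE => /eqP ->; rewrite div0n invr0 mulr0.
  rewrite -dvdn_divisors // => dn; have d_gt0 := dvdn_gt0 (ltn0Sn n) dn.
  by rewrite -invfM -natrM mulnC divnK.
pose tau n : R := \sum_(d <- divisors n) 1.
have tau_le : \sum_(1 <= n < X.+1) tau n / n%:R <= harmonic_sum X ^+ 2.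
  apply: le_trans (dirichlet (fun n => n%:R^-1) inv_ge0).
  apply: ler_sum => n _; rewrite /tau big_distrl /= big_seq [leRHS]big_seq.
  by apply: ler_sum => d dn; rewrite mul1r (divE n d).
have tau_ge0 n : 0 <= tau n / n%:R by rewrite mulr_ge0 // sumr_ge0.
apply: (@le_trans _ _ ((\sum_(1 <= n < X.+1) tau n / n%:R) * harmonic_sum X)).
  apply: le_trans (dirichlet (fun n => tau n / n%:R) tau_ge0).
  apply: ler_sum => n _; rewrite /tau3 natr_sum big_distrl /= big_seq [leRHS]big_seq.
  apply: ler_sum => d dn; rewrite (divE n d) // mulrA ler_wpM2r // natr_sum.
  by rewrite ler_wpM2r.
by rewrite exprSr ler_wpM2r // sumr_ge0.
Qed.

Lemma sum_divisors_primorial_multf (F : nat -> nat -> R) N K :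
  (forall q, F q 0%N = 1) ->
  \sum_(d <- divisors (\prod_(0 <= p < N | prime p) p ^ K)) multf F d
  = \prod_(0 <= p < N | prime p) partial_sums F p K.
Proof.
move=> F0; rewrite sum_divisors_multf //; last first.
  by rewrite prodn_cond_gt0 // => p p_pr; rewrite expn_gt0 prime_gt0.
elim: N => [|N IHN]; first by rewrite !big_nil multf1.
rewrite [in LHS]big_mkcond [RHS]big_mkcond !big_nat_recr //=.
rewrite -[in LHS]big_mkcond -[in RHS]big_mkcond.
case: ifP => N_pr; last by rewrite muln1 mulr1.
have m_gt0 : (0 < \prod_(0 <= p < N | prime p) p ^ K)%N.
  by rewrite prodn_cond_gt0 // => p p_pr; rewrite expn_gt0 prime_gt0.
have NNm : ~~ (N %| \prod_(0 <= p < N | prime p) p ^ K)%N.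
  rewrite Euclid_dvd_prod // big_has_cond; apply/hasPn => p.
  rewrite mem_index_iota => /= pN; rewrite negb_and; case: (boolP (prime p)) => //= p_pr.
  by rewrite Euclid_dvdX // negb_and dvdn_prime2 // gtn_eqF.
move: IHN m_gt0 NNm; move: (\prod_(0 <= p < N | prime p) p ^ K)%N => m IHN m_gt0 NNm.
rewrite [X in multf _ X]mulnC multf_pM // => [|q]; last by rewrite partial_sums0.
by rewrite IHN mulrC.
Qed.
End GlobalMean.

(** * Tails of the majorant *)

Section Tail.
Variable R : realFieldType.
Implicit Types (X Y J : nat).

Lemma harmonic_sum_ge1 X : (0 < X)%N -> 1 <= harmonic_sum R X.
Proof.
move=> X_gt0; rewrite /harmonic_sum big_ltn // invr1 lerDl.
by apply: sumr_ge0 => n _; rewrite invr_ge0.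
Qed.

Lemma harmonic_sum_double X : (0 < X)%N ->
  harmonic_sum R (2 * X) <= harmonic_sum R X + 1.
Proof.
move=> X_gt0; rewrite /harmonic_sum (@big_cat_nat _ _ _ X.+1) //=; last first.
  by rewrite ltnS leq_pmull.
rewrite lerD2l; apply: (@le_trans _ _ (\sum_(X.+1 <= n < (2 * X).+1) X%:R^-1)).
  rewrite big_nat [leRHS]big_nat; apply: ler_sum => n /andP[Xn _].
  by rewrite lef_pV2 ?posrE ?ltr0n ?ler_nat ?(ltnW Xn) // (leq_trans _ Xn).
rewrite sumr_const_nat (_ : (_ - _)%N = X); last by lia.
by rewrite -[_ *+ _]mulr_natr mulVf // pnatr_eq0 -lt0n.
Qed.

(** Chosen so that [dyadic_poly h = (h + 1) ^+ 3 + dyadic_poly (h + 1) / 2], which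
    is the recursion that the tail bound has to satisfy when [X] is doubled. *)
Definition dyadic_poly (h : R) : R := 2 * h ^+ 3 + 12 * h ^+ 2 + 36 * h + 52.

(** On the block from [X] to [2 * X] one factor [1 / n] is at most [1 / X] and
    [sum_tau3_le] bounds the rest by [(h + 1) ^+ 3], where [h] is the harmonic sum
    up to [X]; the remaining blocks are those for [2 * X]. *)
Lemma sum_tau3_dyadic J X : (0 < X)%N ->
  \sum_(X.+1 <= n < (2 ^ J * X).+1) (tau3 n)%:R / n%:R / n%:R
  <= dyadic_poly (harmonic_sum R X) / X%:R.
Proof.
have h_ge1 := harmonic_sum_ge1.
elim: J X => [|J IHJ] X X_gt0.
  rewrite expn0 mul1n big_geq // divr_ge0 // /dyadic_poly.
  by have := h_ge1 X X_gt0; nra.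
have X2_gt0 : (0 < 2 * X)%N by rewrite muln_gt0.
have XR_gt0 : 0 < X%:R :> R by rewrite ltr0n.
rewrite (@big_cat_nat _ _ _ (2 * X).+1) /=; last 2 first.
- by rewrite ltnS leq_pmull.
- by rewrite ltnS leq_pmul2r // -{1}(expn1 2) leq_pexp2l.
set h := harmonic_sum R X; set h2 := harmonic_sum R (2 * X).
have h2_le : h2 <= h + 1 := harmonic_sum_double X_gt0.
have h2_ge1 : 1 <= h2 := h_ge1 _ X2_gt0.
have block : \sum_(X.+1 <= n < (2 * X).+1) (tau3 n)%:R / n%:R / n%:R
    <= (h + 1) ^+ 3 / X%:R.
  apply: (@le_trans _ _ ((\sum_(1 <= n < (2 * X).+1) (tau3 n)%:R / n%:R) / X%:R)).
    rewrite (@big_cat_nat _ _ _ X.+1 1) //=; last by rewrite ltnS leq_pmull.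
    rewrite mulrDl -[leLHS]add0r; apply: lerD.
      by rewrite divr_ge0 // sumr_ge0 // => n _; rewrite divr_ge0.
    rewrite big_distrl big_nat [leRHS]big_nat; apply: ler_sum => n /andP[Xn _] /=.
    apply: ler_wpM2l; first by rewrite divr_ge0.
    by rewrite lef_pV2 ?posrE ?ltr0n ?ler_nat ?(ltnW Xn) // (leq_trans _ Xn).
  rewrite ler_pM2r ?invr_gt0 //; apply: le_trans (sum_tau3_le R _) _.
  by rewrite -/h2 lerXn2r ?nnegrE //; lra.
have rest := IHJ _ X2_gt0; rewrite mulnA -expnSr -/h2 in rest.
apply: le_trans (lerD block rest) _.
have tail_le : dyadic_poly h2 <= dyadic_poly (h + 1).
  have h23 : h2 ^+ 3 <= (h + 1) ^+ 3 by rewrite lerXn2r ?nnegrE //; lra.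
  have h22 : h2 ^+ 2 <= (h + 1) ^+ 2 by rewrite lerXn2r ?nnegrE //; lra.
  rewrite /dyadic_poly; lra.
apply: (@le_trans _ _ ((h + 1) ^+ 3 / X%:R + dyadic_poly (h + 1) / (2 * X)%:R)).
  by rewrite lerD2l ler_pM2r ?invr_gt0 ?ltr0n.
rewrite le_eqVlt; apply/orP; left; apply/eqP; rewrite /dyadic_poly natrM.
by field; rewrite lt0r_neq0.
Qed.

(** The constant 102 is the sum of the coefficients of [dyadic_poly]: the harmonic
    sum is at least 1, so its cube bounds all its lower powers. *)
Lemma sum_tau3_tail X Y : (0 < X)%N ->
  \sum_(X.+1 <= n < Y.+1) (tau3 n)%:R / n%:R / n%:R
  <= 102 * harmonic_sum R X ^+ 3 / X%:R.
Proof.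
move=> X_gt0; have h_ge1 := harmonic_sum_ge1 X_gt0.
apply: (@le_trans _ _ (dyadic_poly (harmonic_sum R X) / X%:R)); last first.
  rewrite ler_pM2r ?invr_gt0 ?ltr0n // /dyadic_poly.
  have h2_ge : harmonic_sum R X <= harmonic_sum R X ^+ 2 by rewrite ler_eXnr.
  have h3_ge : harmonic_sum R X ^+ 2 <= harmonic_sum R X ^+ 3 by rewrite ler_weXn2l.
  lra.
apply: le_trans (sum_tau3_dyadic Y X_gt0).
have [XY|YX] := leqP X Y; last first.
  by rewrite [leLHS]big_geq 1?ltnW // sumr_ge0 // => n _; rewrite !divr_ge0.
rewrite [leRHS](@big_cat_nat _ _ _ Y.+1) //=; last first.
  by rewrite ltnS (leq_trans (ltnW (ltn_expl Y (ltnSn 1)))) // leq_pmulr.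
by rewrite lerDl sumr_ge0 // => n _; rewrite !divr_ge0.
Qed.
End Tail.

(** * The constant as an Euler product *)

From mathcomp Require Import all_classical all_reals all_analysis.
Import numFieldNormedType.Exports.
Local Open Scope classical_set_scope.
Local Open Scope ring_scope.

Section EulerProduct.
Variable R : realType.

Lemma mean_exponentE n : (0 < n)%N ->
  mean_exponent R n = (sigma n)%:R ^+ 2 / (gcd_sum n)%:R.
Proof.
move=> n_gt0; rewrite /mean_exponent -natr_sum /Zsq.
rewrite (sum_exponent_subgroups (cyclic_Zp n) (cyclic_Zp n)).
rewrite (card_subgroups_setX_cyclic (cyclic_Zp n) (cyclic_Zp n)).
by rewrite card_Zp // natrM expr2.
Qed.

Lemma cvg_prod_seq (I : Type) (r : seq I) (P : pred I) (f : I -> nat -> R) (l : I -> R) :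
  (forall i, P i -> f i @ \oo --> l i) ->
  (fun K => \prod_(i <- r | P i) f i K) @ \oo --> \prod_(i <- r | P i) l i.
Proof.
move=> fl; elim: r => [|i r IHr].
  by under eq_fun do rewrite big_nil; rewrite big_nil; apply: cvg_cst.
rewrite big_cons; case: ifP => Pi; last by under eq_fun do rewrite big_cons Pi.
by under eq_fun do rewrite big_cons Pi; apply: cvgM => //; apply: fl.
Qed.

Section PrimeFactor.
Variable p : nat.
Hypothesis p_pr : prime p.

Lemma prime_ge2r : 2 <= p%:R :> R.
Proof. by rewrite ler_nat prime_gt1. Qed.

Lemma M_termE k : M_term R p k = mean_loc p%:R k / p%:R ^+ k.
Proof.
have p_ge2 := prime_ge2r; have p_ge0 : 0 <= p%:R :> R by [].
have g_neq0 := lt0r_neq0 (gcd_loc_gt0 k p_ge0).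
have pk_neq0 : p%:R ^+ k != 0 :> R by rewrite expf_neq0 // lt0r_neq0 //; lra.
have p1_neq0 : p%:R - 1 != 0 :> R by rewrite lt0r_neq0 //; lra.
rewrite /M_term /mean_loc -gcd_loc_closed -sigma_loc_closed mulnC exprM.
by field; rewrite g_neq0 pk_neq0.
Qed.

Lemma M_term_bound k : 0 <= M_term R p k <= geometric 2 2^-1 k.
Proof.
have p_ge2 := prime_ge2r; have p_ge0 : 0 <= p%:R :> R by [].
have p_gt0 : 0 < p%:R :> R by lra.
have g_gt0 := gcd_loc_gt0 k p_ge0; have s_ge1 := sigma_loc_ge1 k p_ge0.
have pk_gt0 : 0 < p%:R ^+ k :> R by rewrite exprn_gt0.
have f_ge0 : 0 <= mean_loc (p%:R : R) k.
  by rewrite divr_ge0 ?sqr_ge0 // mulr_ge0 // ltW.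
have f_le2 : mean_loc (p%:R : R) k <= 2.
  rewrite ler_pdivrMr ?mulr_gt0 // mulrA expr2 ler_pM ?le_sigma_gcd_loc //; try lra.
  exact: sigma_loc_le.
rewrite M_termE divr_ge0 ?(ltW pk_gt0) //= ler_pM ?invr_ge0 ?(ltW pk_gt0) //.
by rewrite -exprVn lerXn2r ?nnegrE ?invr_ge0 // lef_pV2 ?posrE.
Qed.

Lemma cvg_series_M_term : cvgn (series (M_term R p)).
Proof.
apply: (@series_le_cvg _ _ (geometric 2 2^-1)) => [k|k|k|].
- by have /andP[] := M_term_bound k.
- by have /andP[] := M_term_bound k; apply: le_trans.
- by have /andP[] := M_term_bound k.
apply: is_cvg_geometric_series; rewrite ger0_norm ?invr_ge0 //; lra.
Qed.

(** Summation by parts. *)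
Lemma sum_mean_diff_div K :
  \sum_(i < K.+1) mean_diff (p%:R : R) i / p%:R ^+ i
  = (1 - p%:R^-1) * series (M_term R p) K.+1 + M_term R p K / p%:R.
Proof.
have p_neq0 : p%:R != 0 :> R by rewrite pnatr_eq0 -lt0n prime_gt0.
elim: K => [|K IHK].
  rewrite big_ord1 /series /= big_nat1 M_termE mean_loc0 expr0 /=.
  by field.
rewrite big_ord_recr IHK /= [series _ K.+2]seriesSr !M_termE exprS.
have pK_neq0 : p%:R ^+ K != 0 :> R by rewrite expf_neq0.
by field; rewrite p_neq0 pK_neq0.
Qed.

Lemma cvg_M_factor :
  (fun K => \sum_(i < K.+1) mean_diff (p%:R : R) i / p%:R ^+ i) @ \oo --> M_factor R p.
Proof.
under eq_fun do rewrite sum_mean_diff_div.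
rewrite -[M_factor R p]addr0 /M_factor; apply: cvgD.
  apply: cvgM; first exact: cvg_cst.
  by rewrite (cvg_shiftS (series (M_term R p))); apply: cvg_series_M_term.
rewrite -(mul0r p%:R^-1); apply: cvgM; last exact: cvg_cst.
exact: cvg_series_cvg_0 cvg_series_M_term.
Qed.
End PrimeFactor.

(** The terms G(n) / n of the series whose sum is M, and a majorant. *)
Definition coef_ratio (n : nat) : R := mean_coef R n / n%:R.
Definition coef_majorant (n : nat) : R := (tau3 n)%:R / n%:R / n%:R.

Lemma norm_coef_ratio_le n : `|coef_ratio n| <= coef_majorant n.
Proof.
case: n => [|n]; first by rewrite /coef_ratio /coef_majorant !invr0 !mulr0 normr0.
by rewrite normrM [`|_^-1|]ger0_norm ?invr_ge0 // ler_wpM2r ?invr_ge0 ?mean_coef_bound.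
Qed.

Lemma coef_majorant_ge0 n : 0 <= coef_majorant n.
Proof. by rewrite !divr_ge0. Qed.

Lemma nondecreasing_coef_majorant : nondecreasing_seq (series coef_majorant).
Proof. by apply: nondecreasing_series => n _ _; apply: coef_majorant_ge0. Qed.

(** The bound of [sum_tau3_tail], in terms of partial sums of the series; it is
    what makes the series converge and gives the rate. *)
Lemma coef_majorant_tail X Y : (0 < X)%N ->
  series coef_majorant Y - series coef_majorant X.+1
  <= 102 * harmonic_sum R X ^+ 3 / X%:R.
Proof.
move=> X_gt0; have h_ge1 := harmonic_sum_ge1 R X_gt0.
have h_ge0 : 0 <= 102 * harmonic_sum R X ^+ 3 / X%:R.
  by rewrite divr_ge0 // mulr_ge0 // exprn_ge0 //; lra.
have [YX|XY] := leqP Y X.+1.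
  by apply: le_trans h_ge0; rewrite subr_le0 nondecreasing_coef_majorant.
rewrite sub_series_geq ?(ltnW XY) //; case: Y XY => // Y XY.
exact: sum_tau3_tail.
Qed.

Lemma cvg_series_coef_majorant : cvgn (series coef_majorant).
Proof.
apply: nondecreasing_is_cvgn; first exact: nondecreasing_coef_majorant.
exists (series coef_majorant 2 + 102 * harmonic_sum R 1 ^+ 3 / 1%:R) => _ [Y _ <-].
by rewrite -lerBlDl coef_majorant_tail.
Qed.

Definition majorant_tail N := limn (series coef_majorant) - series coef_majorant N.

Lemma majorant_tail_le X : (0 < X)%N ->
  majorant_tail X.+1 <= 102 * harmonic_sum R X ^+ 3 / X%:R.
Proof.
move=> X_gt0; rewrite lerBlDl; apply: limr_le; first exact: cvg_series_coef_majorant.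
by apply: nearW => Y; rewrite -lerBlDl coef_majorant_tail.
Qed.

Lemma cvg_majorant_tail : majorant_tail @ \oo --> 0.
Proof.
rewrite -(subrr (limn (series coef_majorant))); apply: cvgB; first exact: cvg_cst.
exact: cvg_series_coef_majorant.
Qed.

Lemma cvg_series_coef_ratio : cvgn (series coef_ratio).
Proof.
apply: normed_cvg; apply: series_le_cvg cvg_series_coef_majorant => n //=.
- exact: coef_majorant_ge0.
- exact: norm_coef_ratio_le.
Qed.

(** Any finite sum containing all the terms below [N] differs from the [N]-th
    partial sum only by terms of index at least [N]. This covers the partial sums
    of the series as well as the finite Euler products. *)
Lemma sum_coef_ratio_near N (D : seq nat) : uniq D ->
  (forall n, (0 < n < N)%N -> n \in D) ->
  `|\sum_(d <- D) coef_ratio d - series coef_ratio N| <= majorant_tail N.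
Proof.
move=> uD DN.
have u0 : coef_ratio 0 = 0 by rewrite /coef_ratio invr0 mulr0.
have D_lt : exists2 Y, (N <= Y)%N & forall d, d \in D -> (d < Y)%N.
  exists (N + \max_(d <- D) d).+1; first by rewrite ltnW // ltnS leq_addr.
  move=> d dD; rewrite ltnS (leq_trans _ (leq_addl _ _)) //.
  exact: (@leq_bigmax_seq _ D xpredT id d).
case: D_lt => Y NY DY.
have -> : \sum_(d <- D) coef_ratio d = \sum_(0 <= d < Y | d \in D) coef_ratio d.
  rewrite -[RHS]big_filter; apply/perm_big/uniq_perm => //.
    by rewrite filter_uniq ?iota_uniq.
  move=> d; rewrite mem_filter mem_index_iota /=.
  by case: (boolP (d \in D)) => //= /DY ->.
rewrite (@big_cat_nat _ _ _ N) //= big_mkcond /=.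
have -> : \sum_(0 <= d < N) (if d \in D then coef_ratio d else 0) = series coef_ratio N.
  rewrite /series /= big_nat [RHS]big_nat; apply: eq_bigr => -[|d] /= dN.
    by rewrite u0 if_same.
  by rewrite DN.
rewrite (addrAC (series coef_ratio N)) subrr add0r.
apply: (@le_trans _ _ (series coef_majorant Y - series coef_majorant N)).
  rewrite sub_series_geq // (le_trans (ler_norm_sum _ _ _)) //.
  rewrite big_mkcond; apply: ler_sum => d _.
  case: ifP => _; first exact: norm_coef_ratio_le.
  exact: coef_majorant_ge0.
rewrite lerD2r; apply: nondecreasing_cvgn_le.
  exact: nondecreasing_coef_majorant.
exact: cvg_series_coef_majorant.
Qed.

(** The product over [p < N] of the local sums truncated at exponent [K] is the
    sum over the divisors of the [K]-th power of the primorial of [N], which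
    include all positive integers below [N] as soon as [N <= K]. The claim follows
    by letting [K] tend to infinity. *)
Lemma M_partial_near N : `|M_partial R N - series coef_ratio N| <= majorant_tail N.
Proof.
pose F p k : R := mean_diff p%:R k / p%:R ^+ k.
pose m K := (\prod_(0 <= p < N | prime p) p ^ K)%N.
have m_gt0 K : (0 < m K)%N.
  by rewrite prodn_cond_gt0 // => p p_pr; rewrite expn_gt0 prime_gt0.
have FE n : (0 < n)%N -> multf F n = coef_ratio n.
  move=> n_gt0; rewrite /coef_ratio /mean_coef -[in RHS](multf_natr R n_gt0).
  by rewrite /multf -prodf_div.
have mE K : \sum_(d <- divisors (m K)) coef_ratio d
    = \prod_(0 <= p < N | prime p) partial_sums F p K.
  rewrite -sum_divisors_primorial_multf => [|q]; last by rewrite /F expr0 divr1.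
  by rewrite big_seq [RHS]big_seq; apply: eq_bigr => d /mem_divisors_gt0/FE.
have cvgP : (fun K => \sum_(d <- divisors (m K)) coef_ratio d) @ \oo --> M_partial R N.
  under eq_fun do rewrite mE.
  by apply: cvg_prod_seq => p p_pr; apply: cvg_M_factor.
have smooth K n : (N <= K)%N -> (0 < n < N)%N -> n \in divisors (m K).
  move=> NK /andP[n_gt0 nN]; rewrite -dvdn_divisors //.
  rewrite -{1}(partnT n_gt0) /partn /m.
  rewrite [X in (_ %| X)%N](@big_cat_nat _ _ _ n.+1) //= dvdn_mulr //.
  rewrite [X in (_ %| X)%N]big_mkcond /=.
  apply: (big_ind2 (fun a b => (a %| b)%N)) => // [a b c d|p _]; first exact: dvdn_mul.
  case: ifPn => p_pr; last by rewrite lognE (negbTE p_pr).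
  by rewrite dvdn_exp2l // (leq_trans _ NK) // ltnW // (ltn_trans (ltn_logl p n_gt0)).
have cvg_dist : (fun K =>
    `|\sum_(d <- divisors (m K)) coef_ratio d - series coef_ratio N|) @ \oo
    --> `|M_partial R N - series coef_ratio N|.
  by apply: cvg_norm; apply: cvgB => //; apply: cvg_cst.
apply: (cvgr_to_le cvg_dist); exists N => // K /= NK.
apply: sum_coef_ratio_near; first exact: divisors_uniq.
by move=> n; apply: smooth.
Qed.

Lemma cvg_M_partial : M_partial R @ \oo --> limn (series coef_ratio).
Proof.
have diff0 : (fun N => M_partial R N - series coef_ratio N) @ \oo --> 0.
  apply/norm_cvg0P; apply: (@squeeze_cvgr _ _ _ _ (cst 0) majorant_tail).
  - by apply: nearW => N; rewrite normr_ge0 M_partial_near.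
  - exact: cvg_cst.
  - exact: cvg_majorant_tail.
rewrite (_ : M_partial R =
  fun N => (M_partial R N - series coef_ratio N) + series coef_ratio N).
  by rewrite -[limn _]add0r; apply: cvgD diff0 cvg_series_coef_ratio.
by apply/funext => N; rewrite subrK.
Qed.

Lemma M_const_near N : `|M_const R - series coef_ratio N| <= majorant_tail N.
Proof.
have -> : M_const R = limn (series coef_ratio) by apply: cvg_lim cvg_M_partial.
have cvg_dist : (fun Y => `|series coef_ratio Y - series coef_ratio N|) @ \oo
    --> `|limn (series coef_ratio) - series coef_ratio N|.
  by apply: cvg_norm; apply: cvgB; [exact: cvg_series_coef_ratio | exact: cvg_cst].
apply: (cvgr_to_le cvg_dist); exists N => // Y /= NY.
have -> : series coef_ratio Y = \sum_(d <- index_iota 0 Y) coef_ratio d by [].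
apply: sum_coef_ratio_near; first exact: iota_uniq.
by move=> n /andP[_ nN]; rewrite mem_index_iota /= (leq_trans nN).
Qed.
End EulerProduct.

(** * The error term *)

Section ErrorTerm.
Variable R : realType.

(** Each step uses [1 / (X + 1) <= ln (X + 1) - ln X], which is
    [ln (1 - t) <= - t] at [t = 1 / (X + 1)]. *)
Lemma harmonic_sum_le_ln X : (0 < X)%N -> harmonic_sum R X <= 1 + ln X%:R.
Proof.
elim: X => // -[_ _|X IHX _].
  by rewrite /harmonic_sum big_nat1 invr1 ln1 addr0.
have X1_gt0 : 0 < X.+1%:R :> R by rewrite ltr0n.
have X2_gt0 : 0 < X.+2%:R :> R by rewrite ltr0n.
rewrite /harmonic_sum big_nat_recr //= -/(harmonic_sum R X.+1).
have inv_lt1 : X.+2%:R^-1 < 1 :> R by rewrite invf_lt1 // ltr1n.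
have ratioE : 1 + - X.+2%:R^-1 = X.+1%:R / X.+2%:R :> R.
  rewrite -[X.+2%:R]natr1; move: (X.+1%:R) X1_gt0 => a a_gt0.
  by field; rewrite lt0r_neq0 //; lra.
have := @le_ln1Dx R (- X.+2%:R^-1); rewrite ltrN2 inv_lt1 => /(_ isT).
rewrite ratioE ln_div ?posrE // => ln_le.
move: ln_le (IHX isT).
move: (harmonic_sum R X.+1) (ln X.+1%:R) (ln X.+2%:R) (X.+2%:R^-1) => h a b c.
lra.
Qed.

Lemma sum_natr m : \sum_(1 <= e < m.+1) e%:R = m%:R * (m%:R + 1) / 2 :> R.
Proof.
elim: m => [|m IHm]; first by rewrite big_geq // mul0r mul0r.
by rewrite big_nat_recr //= IHm -natr1; field.
Qed.

Lemma sum_mean_exponent X :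
  \sum_(1 <= n < X.+1) mean_exponent R n
  = \sum_(1 <= d < X.+1) mean_coef R d * (d%:R * \sum_(1 <= e < (X %/ d).+1) e%:R).
Proof.
transitivity (\sum_(1 <= d < X.+1) \sum_(1 <= e < (X %/ d).+1)
    mean_coef R d * (d%:R * e%:R)); last first.
  by apply: eq_bigr => d _; rewrite !big_distrr.
rewrite -(sum_divisors_swap (fun d e => mean_coef R d * (d%:R * e%:R))).
rewrite big_nat [RHS]big_nat; apply: eq_bigr => n /andP[n_gt0 _].
rewrite mean_exponentE // mean_expand // big_distrr big_seq [RHS]big_seq.
apply: eq_bigr => d; rewrite -dvdn_divisors // => dn /=.
by rewrite -natrM (mulnC d) divnK // mulrC.
Qed.

(** With [y = x / d] and [m] its integer part, the sum [m * (m + 1) / 2] lies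
    between [y * (y - 1) / 2] and [y * (y + 1) / 2]. *)
Lemma floor_sum_error (x : R) X d : (0 < d)%N -> X%:R <= x < X%:R + 1 ->
  `|d%:R * \sum_(1 <= e < (X %/ d).+1) e%:R - x ^+ 2 / 2 / d%:R| <= x / 2.
Proof.
move=> d_gt0 /andP[Xx xX]; rewrite sum_natr; set m := (X %/ d)%N.
have d_gt0R : 0 < d%:R :> R by rewrite ltr0n.
set y := x / d%:R; have xE : x = d%:R * y by rewrite mulrC divfK ?lt0r_neq0.
have my : m%:R <= y.
  by rewrite ler_pdivlMr // -natrM (le_trans _ Xx) // ler_nat leq_divM.
have ym : y < m%:R + 1.
  rewrite ltr_pdivrMr // (lt_le_trans xX) // natr1 natr1 -natrM ler_nat.
  by rewrite ltn_ceil.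
have m_ge0 : 0 <= m%:R :> R by [].
have -> : d%:R * (m%:R * (m%:R + 1) / 2) - x ^+ 2 / 2 / d%:R
    = d%:R * ((m%:R * (m%:R + 1) - y ^+ 2) / 2).
  by rewrite xE; field; rewrite lt0r_neq0.
rewrite normrM (ger0_norm (ltW d_gt0R)) xE -mulrA ler_pM2l // ler_norml.
by apply/andP; split; nra.
Qed.

(** The rounding errors contribute [x / 2 * h ^+ 3]; replacing the partial sum of
    the series by its limit contributes [102 * x * h ^+ 3], because
    [x <= X + 1 <= 2 * X]. *)
Lemma mean_exponent_sum_error (x : R) : 1 <= x ->
  `|\sum_(1 <= n < (Num.truncn x).+1) mean_exponent R n - M_const R / 2 * x ^+ 2|
  <= 103 * (x * harmonic_sum R (Num.truncn x) ^+ 3).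
Proof.
move=> x_ge1; have x_ge0 : 0 <= x by lra.
have /andP[Xx xX] := truncn_itv x_ge0; set X := Num.truncn x in Xx xX *.
have X_gt0 : (0 < X)%N by rewrite truncn_gt0.
rewrite -natr1 in xX; have Xx_lt : X%:R <= x < X%:R + 1 by rewrite Xx xX.
set h := harmonic_sum R X; have h_ge1 : 1 <= h := harmonic_sum_ge1 R X_gt0.
have X_ge1 : 1 <= X%:R :> R by rewrite ler1n.
set S := series (@coef_ratio R) X.+1.
have SE : S = \sum_(1 <= d < X.+1) coef_ratio R d.
  by rewrite /S /series /= big_ltn // {1}/coef_ratio invr0 mulr0 add0r.
have sum_err : `|\sum_(1 <= n < X.+1) mean_exponent R n - x ^+ 2 / 2 * S|
    <= x / 2 * h ^+ 3.
  rewrite sum_mean_exponent SE big_distrr -sumrB /=.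
  apply: le_trans (ler_norm_sum _ _ _) _.
  apply: le_trans (ler_wpM2l _ (sum_tau3_le R X)); last by lra.
  rewrite big_distrr [leLHS]big_nat [leRHS]big_nat.
  apply: ler_sum => d /andP[d_gt0 _] /=.
  rewrite /coef_ratio (_ : x ^+ 2 / 2 * (mean_coef R d / d%:R)
    = mean_coef R d * (x ^+ 2 / 2 / d%:R)).
    rewrite -mulrBr normrM [leRHS]mulrC ler_pM ?normr_ge0 ?mean_coef_bound //.
    exact: floor_sum_error.
  by rewrite mulrCA mulrA.
have tail_err : `|M_const R - S| <= 102 * h ^+ 3 / X%:R.
  exact: le_trans (M_const_near R X.+1) (majorant_tail_le R X_gt0).
have tail_x : x ^+ 2 / 2 * (102 * h ^+ 3 / X%:R) <= 102 * (x * h ^+ 3).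
  have h3_ge0 : 0 <= h ^+ 3 by rewrite exprn_ge0 //; lra.
  have -> : x ^+ 2 / 2 * (102 * h ^+ 3 / X%:R) = (x * h ^+ 3) * (51 * x / X%:R).
    by field; rewrite pnatr_eq0 -lt0n.
  rewrite [leRHS]mulrC; apply: ler_wpM2l; first by rewrite mulr_ge0.
  by rewrite ler_pdivrMr ?ltr0n //; lra.
have -> : \sum_(1 <= n < X.+1) mean_exponent R n - M_const R / 2 * x ^+ 2
    = (\sum_(1 <= n < X.+1) mean_exponent R n - x ^+ 2 / 2 * S)
      - x ^+ 2 / 2 * (M_const R - S) by ring.
apply: le_trans (ler_normB _ _) _; rewrite [X in _ + X <= _]normrM ger0_norm; last first.
  by rewrite divr_ge0 ?exprn_ge0.
have x2_ge0 : 0 <= x ^+ 2 / 2 by rewrite divr_ge0 ?exprn_ge0.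
have := ler_wpM2l x2_ge0 tail_err.
have xh_ge0 : 0 <= x * h ^+ 3 by rewrite mulr_ge0 // exprn_ge0 //; lra.
lra.
Qed.
End ErrorTerm.

Theorem proposition3p3 (R : realType) :
  [/\ forall p : nat, prime p -> cvgn (series (M_term R p)),
      cvgn (M_partial R)
    & (fun x : R => \sum_(1 <= n < (Num.truncn x).+1) mean_exponent R n)
      = (fun x : R => M_const R / 2 * x ^+ 2)
        +O_ +oo (fun x : R => x * ln x ^+ 3) ].
Proof.
split; first exact: cvg_series_M_term.
  by apply: cvgP; apply: cvg_M_partial.
apply/eqaddOP; near=> k; near=> x.
have x_ge : expR 1 <= x by near: x; apply: nbhs_pinfty_ge; exact: num_real.
have x_ge2 : 2 <= x by apply: le_trans x_ge; have := @expR_ge1Dx R 1; lra.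
have x_gt0 : 0 < x by lra.
have lnx_ge1 : 1 <= ln x by rewrite -[leLHS]expRK ler_ln ?posrE ?expR_gt0.
have x_ge1 : 1 <= x by lra.
have X_gt0 : (0 < Num.truncn x)%N by rewrite truncn_gt0.
have h_le : harmonic_sum R (Num.truncn x) <= 2 * ln x.
  have Xx : (Num.truncn x)%:R <= x by have /andP[] := truncn_itv (ltW x_gt0).
  have : ln (Num.truncn x)%:R <= ln x by rewrite ler_ln ?posrE ?ltr0n.
  by have := harmonic_sum_le_ln R X_gt0; lra.
have h_ge0 : 0 <= harmonic_sum R (Num.truncn x).
  by have := harmonic_sum_ge1 R X_gt0; lra.
have h3_le : harmonic_sum R (Num.truncn x) ^+ 3 <= 8 * ln x ^+ 3.
  rewrite (_ : 8 * _ = (2 * ln x) ^+ 3); last by ring.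
  by rewrite lerXn2r ?nnegrE //; lra.
have e_ge0 : 0 <= x * ln x ^+ 3 by rewrite mulr_ge0 ?exprn_ge0 //; lra.
rewrite [X in `|X|](_ : _ = \sum_(1 <= n < (Num.truncn x).+1) mean_exponent R n
   - M_const R / 2 * x ^+ 2) // (ger0_norm e_ge0).
apply: le_trans (mean_exponent_sum_error x_ge1) _.
(* 824 = 103 * 2 ^ 3, as the harmonic sum is at most 1 + ln x <= 2 * ln x. *)
apply: (@le_trans _ _ (824 * (x * ln x ^+ 3))).
  have : x * harmonic_sum R (Num.truncn x) ^+ 3 <= x * (8 * ln x ^+ 3).
    by rewrite ler_wpM2l //; lra.
  rewrite mulrCA; lra.
by rewrite ler_wpM2r //; near: k; apply: nbhs_pinfty_ge; exact: num_real.
Unshelve. all: by end_near.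
Qed.
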